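(* For every integer $n\ge 4$ there exist two double complexes $\mathcal A,\mathcal B$ in $\mathrm{DC}^{\mathrm{form}}_n$ which are locally similar but which have different zigzag multiplicities, i.e. there is a zigzag $Z$ with $\mathrm{mult}_Z(\mathcal A)\neq \mathrm{mult}_Z(\mathcal B)$.
   Context: A double complex is a bigraded complex vector space $\mathcal A=\bigoplus_{p,q\in\mathbb Z}\mathcal A^{p,q}$ with linear maps $\partial$ of bidegree $(1,0)$ and $\overline\partial$ of bidegree $(0,1)$ such that $\partial^2=\overline\partial^2=\partial\overline\partial+\overline\partial\partial=0$. It is bounded if $\mathcal A^{p,q}=0$ for $|p|+|q|$ large. It is minimal if $\partial\overline\partial=0$. A square is a double complex with one copy of $\mathbb C$ in each of the bidegrees $(p,q),(p+1,q),(p,q+1),(p+1,q+1)$, zero elsewhere, with all four maps between these copies isomorphisms. A zigzag of length $1$ (a dot) is a copy of $\mathbb C$ in one bidegree with zero maps. For $k\in\mathbb Z$ consider the path graph on bidegrees of total degree $k$ and $k+1$ in which $(r,s)$ with $r+s=k$ is joined to $(r+1,s)$ and to $(r,s+1)$. A zigzag of length $m\geq2$ is the double complex with one copy of $\mathbb C$ at each of $m$ consecutive vertices of such a path, the maps along edges between these vertices being isomorphisms and all other maps zero. A zigzag is determined up to isomorphism by its support. Every bounded double complex is isomorphic to a direct sum of squares and zigzags, with uniquely determined multiplicities $\mathrm{mult}_S$. $\mathrm{DC}^{\mathrm{form}}_n$ (double complexes of formal dimension $n$) is the class of double complexes $\mathcal A$ such that: $\mathcal A^{p,q}=0$ unless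 $0\le p\le n$ and $0\le q\le n$; the only zigzags in the decomposition having a component in one of the corners $(0,0),(n,0),(0,n),(n,n)$ are dots; there are finitely many zigzags in the decomposition; the multiplicities of zigzags are invariant under the reflection $(p,q)\mapsto(q,p)$ and under the reflection $(p,q)\mapsto(n-q,n-p)$ (a zigzag is sent to the zigzag whose support is the image of its support). Two bounded double complexes are quasi-isomorphic iff all zigzags have the same multiplicities in both. For a minimal double complex $\mathcal A$ and a bidegree $(p,q)$, the local complex $\mathcal A_{p,q}^{\bullet,\bullet}$ is the double complex with $\mathcal A_{p,q}^{r,s}=\mathcal A^{r,s}$ if $|r-p|+|s-q|\le 1$ and $0$ otherwise, whose differentials are those of $\mathcal A$ whenever source and target are both retained, and $0$ otherwise. Two double complexes $\mathcal A,\mathcal B$ are locally similar if there are minimal double complexes $\mathcal A',\mathcal B'$, quasi-isomorphic to $\mathcal A$ and $\mathcal B$ respectively, such that $\mathcal A'^{\bullet,\bullet}_{p,q}\simeq\mathcal B'^{\bullet,\bullet}_{p,q}$ for every bidegree $(p,q)$. *)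

(* Defs.v *)
From HB Require Import structures.
From mathcomp Require Import all_boot all_order all_algebra.
From mathcomp Require Import boolp classical_sets functions cardinality fsbigop.
From mathcomp Require Import reals complex.

Set Implicit Arguments.
Unset Strict Implicit.
Unset Printing Implicit Defensive.

Import Order.TTheory GRing.Theory Num.Theory.
Local Open Scope classical_set_scope.
Local Open Scope card_scope.
Local Open Scope ring_scope.

(* The definitions make sense over any field K; the theorem takes K = R[i]. *)

Record dcomplex (K : fieldType) := DComplex {
  dc_obj :> int -> int -> lmodType K;
  del : forall p q, {linear dc_obj p q -> dc_obj (p + 1) q};
  delbar : forall p q, {linear dc_obj p q -> dc_obj p (q + 1)};
  del_del : forall p q (x : dc_obj p q), del (p + 1) q (del p q x) = 0;
  delbar_delbar : forall p q (x : dc_obj p q),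
    delbar p (q + 1) (delbar p q x) = 0;
  del_delbar : forall p q (x : dc_obj p q),
    del p (q + 1) (delbar p q x) + delbar (p + 1) q (del p q x) = 0 }.

Arguments del {K} A p q : rename.
Arguments delbar {K} A p q : rename.

Definition bounded_dc (K : fieldType) (A : dcomplex K) : Prop :=
  exists N : int, forall p q : int,
    N < `|p| + `|q| -> forall x : A p q, x = 0.

Definition minimal_dc (K : fieldType) (A : dcomplex K) : Prop :=
  forall p q (x : A p q), del A p (q + 1) (delbar A p q x) = 0.

Record dc_hom (K : fieldType) (A B : dcomplex K) := DCHom {
  dc_fun :> forall p q, {linear A p q -> B p q};
  dc_fun_del : forall p q (x : A p q),
    dc_fun (p + 1) q (del A p q x) = del B p q (dc_fun p q x);
  dc_fun_delbar : forall p q (x : A p q),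
    dc_fun p (q + 1) (delbar A p q x) = delbar B p q (dc_fun p q x) }.

Definition dc_iso (K : fieldType) (A B : dcomplex K) : Prop :=
  exists f : dc_hom A B, forall p q, bijective (f p q).

(* For k fixed and t ranging over int, path_vertex k enumerates the path graph
   on the bidegrees of total degree k and k + 1: the vertex 2r is (r, k - r),
   the vertex 2r + 1 is (r + 1, k - r), and t is joined to t - 1 and t + 1. *)
Definition path_vertex (k t : int) : int * int :=
  ((t %/ 2)%Z + (t %% 2)%Z, k - (t %/ 2)%Z).

Lemma path_vertex_even (k r : int) : path_vertex k (r * 2) = (r, k - r).
Proof. by rewrite /path_vertex modzMl mulzK // addr0. Qed.

Lemma path_vertex_odd (k r : int) :
  path_vertex k (r * 2 + 1) = (r + 1, k - r).
Proof. by rewrite /path_vertex divzMDl // modzMDl addr0. Qed.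

(* Long k t m is the zigzag of length m + 2 supported on the vertices
   t, ..., t + m + 1 of the path k. Distinct zigzags have distinct supports;
   this is why dots, which lie on two paths, have their own constructor. *)
Inductive zigzag :=
  | Dot of int & int
  | Long of int & int & nat.

Definition zigzag_supp (Z : zigzag) : set (int * int) :=
  match Z with
  | Dot p q => [set (p, q)]
  | Long k t m =>
      [set path_vertex k (t + j%:Z) | j in [set j : nat | (j < m.+2)%N]]
  end.

Inductive shape :=
  | Square of int & int
  | Zigzag of zigzag.

Definition shape_supp (s : shape) : set (int * int) :=
  match s with
  | Square p q =>
      [set (p, q)] `|` [set (p + 1, q)] `|` [set (p, q + 1)]
      `|` [set (p + 1, q + 1)]
  | Zigzag Z => zigzag_supp Z
  end.

(* In the support of a square or of a zigzag, two bidegrees that differ by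
   (1, 0) or (0, 1) always carry one of the isomorphisms of that shape. *)
Definition has_shape (K : fieldType) (A : dcomplex K) (s : shape) : Prop :=
  [/\ forall p q, shape_supp s (p, q) ->
        exists f : {linear K^o -> A p q}, bijective f,
      forall p q, ~ shape_supp s (p, q) -> forall x : A p q, x = 0,
      forall p q, shape_supp s (p, q) -> shape_supp s (p + 1, q) ->
        bijective (del A p q)
    & forall p q, shape_supp s (p, q) -> shape_supp s (p, q + 1) ->
        bijective (delbar A p q)].

(* The canonical map from the direct sum of the F i to A is bijective in each
   bidegree. Finite support is required because \sum_(i \in _) is 0 when the
   summand has infinite support. *)
Definition is_direct_sum (K : fieldType) (A : dcomplex K) (I : choiceType)
    (F : I -> dcomplex K) (inj : forall i, dc_hom (F i) A) : Prop :=
  forall p q (x : A p q), exists! f : (forall i, F i p q),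
    finite_set [set i | f i != 0] /\
    x = \sum_(i \in [set: I]) inj i p q (f i).

Record decomposition (K : fieldType) (A : dcomplex K) := Decomposition {
  dec_index : choiceType;
  dec_shape : dec_index -> shape;
  dec_summand : dec_index -> dcomplex K;
  dec_inj : forall i, dc_hom (dec_summand i) A;
  dec_shapeP : forall i, has_shape (dec_summand i) (dec_shape i);
  dec_sum : is_direct_sum dec_inj }.

Arguments dec_shape {K A} D i : rename.

(* The multiplicity of Z is the cardinality of this set; it may be infinite,
   so multiplicities are compared by equipotence #=. *)
Definition mult_set (K : fieldType) (A : dcomplex K) (D : decomposition A)
    (Z : zigzag) : set (dec_index D) :=
  [set i | dec_shape D i = Zigzag Z].

Arguments mult_set {K A} D Z.

(* Multiplicities do not depend on the decomposition, so the negation of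
   same_mult, which ranges over all decompositions of A and B, says that the
   multiplicities of Z in A and B differ. *)
Definition same_mult (K : fieldType) (A B : dcomplex K) (Z : zigzag) : Prop :=
  exists (DA : decomposition A) (DB : decomposition B),
    mult_set DA Z #= mult_set DB Z.

Definition quasi_iso (K : fieldType) (A B : dcomplex K) : Prop :=
  [/\ bounded_dc A, bounded_dc B & forall Z, same_mult A B Z].

Definition is_corner (n : int) (v : int * int) : Prop :=
  [\/ v = (0, 0), v = (n, 0), v = (0, n) | v = (n, n)].

Definition is_dot (Z : zigzag) : Prop := exists p q, Z = Dot p q.

Definition refl_diag (v : int * int) : int * int := (v.2, v.1).

Definition refl_antidiag (n : int) (v : int * int) : int * int :=
  (n - v.2, n - v.1).

Definition mult_invariant (K : fieldType) (A : dcomplex K)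
    (D : decomposition A) (rho : int * int -> int * int) : Prop :=
  forall Z Z', zigzag_supp Z' = rho @` zigzag_supp Z ->
    mult_set D Z #= mult_set D Z'.

Definition DCform (K : fieldType) (n : int) (A : dcomplex K) : Prop :=
  (forall p q : int, ~~ ((0 <= p <= n) && (0 <= q <= n)) ->
     forall x : A p q, x = 0) /\
  exists D : decomposition A,
    [/\ forall i Z v, dec_shape D i = Zigzag Z -> is_corner n v ->
          zigzag_supp Z v -> is_dot Z,
        finite_set [set i | exists Z, dec_shape D i = Zigzag Z],
        mult_invariant D refl_diag
      & mult_invariant D (refl_antidiag n)].

Definition trunc (K : fieldType) (b : bool) (V : lmodType K) : lmodType K :=
  if b then V else 'rV[K]_0.

Definition trunc_map (K : fieldType) (b c : bool) (V W : lmodType K)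
    (f : {linear V -> W}) : {linear trunc b V -> trunc c W} :=
  match b, c return {linear trunc b V -> trunc c W} with
  | true, true => f
  | _, _ => \0
  end.

Lemma trunc_map_comp0 (K : fieldType) (a b c : bool) (U V W : lmodType K)
    (f : {linear U -> V}) (g : {linear V -> W}) (x : trunc a U) :
  (forall y, g (f y) = 0) -> trunc_map b c g (trunc_map a b f x) = 0.
Proof.
move=> gf0; case: a x => x; case: b; case: c => //=; exact: linear0.
Qed.

Section Local.
Variables (K : fieldType) (A : dcomplex K) (minA : minimal_dc A) (p q : int).

Definition local_supp (r s : int) : bool := `|r - p| + `|s - q| <= 1.

Definition local_obj (r s : int) : lmodType K :=
  trunc (local_supp r s) (A r s).

Definition local_del r s : {linear local_obj r s -> local_obj (r + 1) s} :=
  trunc_map (local_supp r s) (local_supp (r + 1) s) (del A r s).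

Definition local_delbar r s :
    {linear local_obj r s -> local_obj r (s + 1)} :=
  trunc_map (local_supp r s) (local_supp r (s + 1)) (delbar A r s).

Lemma local_del_del r s (x : local_obj r s) :
  local_del (r + 1) s (local_del r s x) = 0.
Proof. exact/trunc_map_comp0/del_del. Qed.

Lemma local_delbar_delbar r s (x : local_obj r s) :
  local_delbar r (s + 1) (local_delbar r s x) = 0.
Proof. exact/trunc_map_comp0/delbar_delbar. Qed.

(* Minimality is needed here: the truncation may keep only one of the two
   sides of an anticommuting square. *)
Lemma local_del_delbar r s (x : local_obj r s) :
  local_del r (s + 1) (local_delbar r s x) +
  local_delbar (r + 1) s (local_del r s x) = 0.
Proof.
have delbar_del0 u v (y : A u v) : delbar A (u + 1) v (del A u v y) = 0.
  by have := del_delbar y; rewrite minA add0r.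
have -> : local_del r (s + 1) (local_delbar r s x) = 0.
  exact/trunc_map_comp0/minA.
have -> : local_delbar (r + 1) s (local_del r s x) = 0.
  exact/trunc_map_comp0/delbar_del0.
exact: addr0.
Qed.

Definition local_dc : dcomplex K :=
  DComplex local_del_del local_delbar_delbar local_del_delbar.

End Local.

Definition locally_similar (K : fieldType) (A B : dcomplex K) : Prop :=
  exists (A' B' : dcomplex K) (minA' : minimal_dc A') (minB' : minimal_dc B'),
    [/\ quasi_iso A' A, quasi_iso B' B
      & forall p q, dc_iso (local_dc minA' p q) (local_dc minB' p q)].

(* Main.v *)
(* Two intervals [a, b] and [c, d] of a path that share an edge have the same
   left ends, right ends and covered vertices as [a, d] and [c, b], and a local
   complex sees nothing more. On the path of total degrees 2 and 3, with
   coordinate p - q, take [-2, 2] and [-1, 1] for A, and [-2, 1] and [-1, 2] for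
   B; both pairs are symmetric under p <-> q, and adding their antidiagonal
   mirror images gives the other symmetry. The multiplicity of [-2, 2] is
   positive in A and zero in B, as is detected by the existence of a nonzero x
   in bidegree (1, 1) whose del and delbar are also the delbar and the del of
   elements of bidegrees (2, 0) and (0, 2). *)

Require Import Defs.
From HB Require Import structures.
From mathcomp Require Import all_boot all_order all_algebra.
From mathcomp Require Import boolp classical_sets functions cardinality fsbigop.
From mathcomp Require Import reals complex.
From mathcomp Require Import zify finmap.

Set Implicit Arguments.
Unset Strict Implicit.
Unset Printing Implicit Defensive.

Import Order.TTheory GRing.Theory Num.Theory.
Local Open Scope ring_scope.

(** * Supports of zigzags in linear coordinates *)

(** On the path [k], the vertex with index [u] is the bidegree with [p - q + k = u], for both
    parities of [u]. Supports thus become intervals described by linear inequalities. *)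
Lemma zigzag_supp_Long (k t : int) (m : nat) (p q : int) :
  zigzag_supp (Long k t m) (p, q) <->
  (p + q = k \/ p + q = k + 1) /\ t <= p - q + k <= t + m%:Z + 1.
Proof.
split=> [[j /= jm] [<- <-]|[pqk tm]].
  by split; lia.
exists (absz (p - q + k - t)%R); first by rewrite /=; lia.
rewrite /path_vertex; congr (_, _); lia.
Qed.

Lemma path_pointP (k u : int) : exists p q : int,
  (p + q = k \/ p + q = k + 1) /\ p - q + k = u.
Proof. by exists ((u %/ 2)%Z + (u %% 2)%Z), (k - (u %/ 2)%Z); lia. Qed.

Lemma zigzag_supp_degree (Z : zigzag) : exists k : int, forall p q,
  zigzag_supp Z (p, q) -> p + q = k \/ p + q = k + 1.
Proof.
case: Z => [a b|k t m]; last by exists k => p q /zigzag_supp_Long[].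
by exists (a + b) => p q [-> ->]; left.
Qed.

(** A long zigzag has two consecutive vertices, so it is not a dot, and these show both total
    degrees, which fixes the path; its extreme positions then fix [t] and [m]. *)
Lemma zigzag_supp_inj : injective zigzag_supp.
Proof.
have suppE (Z Z' : zigzag) : zigzag_supp Z = zigzag_supp Z' ->
    forall p q, zigzag_supp Z (p, q) <-> zigzag_supp Z' (p, q) by move=> ->.
have DotLong a b k t m : zigzag_supp (Defs.Dot a b) <> zigzag_supp (Long k t m).
  move=> /suppE E.
  have [p [q [pqk pqt]]] := path_pointP k t.
  have [p' [q' [pqk' pqt']]] := path_pointP k (t + 1).
  have /E[pa qb] : zigzag_supp (Long k t m) (p, q).
    by apply/zigzag_supp_Long; lia.
  have /E[pa' qb'] : zigzag_supp (Long k t m) (p', q').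
    by apply/zigzag_supp_Long; lia.
  lia.
have LongW k t m k' t' m' :
    zigzag_supp (Long k t m) = zigzag_supp (Long k' t' m') ->
    [/\ k = k', t' <= t & t + m%:Z <= t' + m'%:Z].
  move=> /suppE E.
  have inE u : t <= u <= t + m%:Z + 1 -> exists p q : int,
      [/\ p + q = k \/ p + q = k + 1, p - q + k = u,
          p + q = k' \/ p + q = k' + 1
        & t' <= p - q + k' <= t' + m'%:Z + 1].
    move=> tu; have [p [q [pqk pqu]]] := path_pointP k u.
    exists p, q.
    have /E/zigzag_supp_Long[] // : zigzag_supp (Long k t m) (p, q).
    by apply/zigzag_supp_Long; rewrite pqu.
  have [|p [q [? ? ? ?]]] := inE t; first by lia.
  have [|p1 [q1 [? ? ? ?]]] := inE (t + 1); first by lia.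
  have [|p2 [q2 [? ? ? ?]]] := inE (t + m%:Z + 1); first by lia.
  by split; lia.
case=> [a b|k t m] [a' b'|k' t' m'] //.
- by move=> /suppE/(_ a b)[/(_ erefl)[-> ->]].
- by move=> /DotLong.
- by move=> /esym/DotLong.
- move=> E; have [-> ? ?] := LongW _ _ _ _ _ _ E.
  have [_ ? ?] := LongW _ _ _ _ _ _ (esym E).
  by congr Long; lia.
Qed.

(** * Finite direct sums of zigzags as explicit minimal complexes *)

Section ZigzagSum.
Variable K : fieldType.

Section Objects.
Variables (I : finType) (zz : I -> zigzag).

Definition zz_at (p q : int) : pred I :=
  fun i => `[< zigzag_supp (zz i) (p, q) >].

Lemma zz_atP p q i : reflect (zigzag_supp (zz i) (p, q)) (zz_at p q i).
Proof. exact: asboolP. Qed.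

Definition zsum_obj (p q : int) : lmodType K :=
  {ffun {i : I | zz_at p q i} -> K^o}.

(** Extension by zero to all of [I]: elements of different bidegrees become functions on the same
    set, with no transport between subtypes. *)
Definition coef p q (x : zsum_obj p q) (i : I) : K :=
  if insub i is Some j then x j else 0.

Definition of_coef p q (g : I -> K) : zsum_obj p q := [ffun j => g (val j)].

Lemma coefK p q (x : zsum_obj p q) : of_coef p q (coef x) = x.
Proof. by apply/ffunP => j; rewrite ffunE /coef valK. Qed.

Lemma of_coefK p q g i :
  coef (of_coef p q g) i = if zz_at p q i then g i else 0.
Proof.
by rewrite /coef; case: insubP => [j -> <-|/negPf ->]; rewrite ?ffunE.
Qed.

Lemma coef_out p q (x : zsum_obj p q) i : ~~ zz_at p q i -> coef x i = 0.
Proof. by move=> /negPf out; rewrite -(coefK x) of_coefK out. Qed.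

Lemma coef_inj p q (x y : zsum_obj p q) : coef x =1 coef y -> x = y.
Proof.
by move=> xy; rewrite -(coefK x) -(coefK y); congr of_coef; exact/funext.
Qed.

Lemma coefP p q (a : K) (x y : zsum_obj p q) i :
  coef (a *: x + y) i = a * coef x i + coef y i.
Proof.
by rewrite /coef; case: insub => [j|]; rewrite ?ffunE ?mulr0 ?addr0.
Qed.

Lemma coef0 p q i : coef (0 : zsum_obj p q) i = 0.
Proof. by rewrite /coef; case: insub => // j; rewrite ffunE. Qed.

Definition const_elt p q (a : K^o) : zsum_obj p q := of_coef p q (fun=> a).

Lemma const_elt_is_linear p q : linear (@const_elt p q).
Proof. by move=> a x y; apply/ffunP => j; rewrite !ffunE. Qed.

HB.instance Definition _ p q := GRing.isLinear.Build K K^o (zsum_obj p q) _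
  (@const_elt p q) (@const_elt_is_linear p q).

End Objects.

Section Transfer.
Variables (I I' : finType) (zz : I -> zigzag) (zz' : I' -> zigzag).
Variables (p q p' q' : int) (h : I' -> option I).

(** A single construction for differentials, inclusions of summands, relabellings and inverses. The
    map [h] goes from target indices to source indices, and [None] gives the coefficient zero. *)
Definition transfer (x : zsum_obj zz p q) : zsum_obj zz' p' q' :=
  of_coef zz' p' q' (fun j => if h j is Some i then coef x i else 0).

Lemma coef_transfer x j : coef (transfer x) j =
  if zz_at zz' p' q' j then if h j is Some i then coef x i else 0 else 0.
Proof. exact: of_coefK. Qed.

Lemma transfer_is_linear : linear transfer.
Proof.
move=> a x y; apply: coef_inj => j; rewrite coefP !coef_transfer.
by case: ifP; case: (h j) => [i|]; rewrite ?coefP ?mulr0 ?addr0.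
Qed.

HB.instance Definition _ := GRing.isLinear.Build K (zsum_obj zz p q)
  (zsum_obj zz' p' q') _ transfer transfer_is_linear.

End Transfer.

Section Complex.
Variables (I : finType) (zz : I -> zigzag).

(** With [h = Some], every arrow of every zigzag is an identity, without signs: anticommutation
    holds because both composites vanish. *)
Definition zsum_del p q : {linear zsum_obj zz p q -> zsum_obj zz (p + 1) q} :=
  @transfer I I zz zz p q (p + 1) q Some.

Definition zsum_delbar p q :
    {linear zsum_obj zz p q -> zsum_obj zz p (q + 1)} :=
  @transfer I I zz zz p q p (q + 1) Some.

(** The support of a zigzag lies in two consecutive total degrees, so it cannot meet both the source
    and the target. This yields the axioms of a double complex as well as minimality. *)
Lemma transfer_comp0 p q p' q' p'' q'' (x : zsum_obj zz p q) :
  p'' + q'' = p + q + 2 ->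
  @transfer I I zz zz p' q' p'' q'' Some (transfer zz p' q' Some x) = 0.
Proof.
move=> deg2; apply: coef_inj => i; rewrite coef0 !coef_transfer.
case: zz_atP => // S2; case: zz_atP => // S1.
case: (boolP (zz_at zz p q i)) => [/zz_atP S0|/coef_out -> //].
have [k kP] := zigzag_supp_degree (zz i).
by have := kP _ _ S0; have := kP _ _ S2; lia.
Qed.

Lemma zsum_del_del p q (x : zsum_obj zz p q) :
  zsum_del (p + 1) q (zsum_del p q x) = 0.
Proof. by apply: transfer_comp0; lia. Qed.

Lemma zsum_delbar_delbar p q (x : zsum_obj zz p q) :
  zsum_delbar p (q + 1) (zsum_delbar p q x) = 0.
Proof. by apply: transfer_comp0; lia. Qed.

Lemma zsum_del_delbar p q (x : zsum_obj zz p q) :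
  zsum_del p (q + 1) (zsum_delbar p q x) +
  zsum_delbar (p + 1) q (zsum_del p q x) = 0.
Proof.
have -> : zsum_del p (q + 1) (zsum_delbar p q x) = 0.
  by apply: transfer_comp0; lia.
have -> : zsum_delbar (p + 1) q (zsum_del p q x) = 0.
  by apply: transfer_comp0; lia.
exact: addr0.
Qed.

Definition zsum : dcomplex K :=
  DComplex zsum_del_del zsum_delbar_delbar zsum_del_delbar.

Lemma minimal_zsum : minimal_dc zsum.
Proof. by move=> p q x; apply: transfer_comp0; lia. Qed.

End Complex.
End ZigzagSum.

(** * The tautological decomposition of such a sum *)

Section ZigzagSumDecomposition.
Variables (K : fieldType).

Lemma transfer_comm (I I' : finType) (zz : I -> zigzag) (zz' : I' -> zigzag)
    (h : I' -> option I) p q p' q' (x : zsum_obj K zz p q) :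
  (forall i j, h j = Some i ->
     zz_at zz' p q j = zz_at zz p q i /\
     zz_at zz' p' q' j = zz_at zz p' q' i) ->
  transfer zz' p' q' h (transfer zz p' q' Some x) =
  transfer zz' p' q' Some (transfer zz' p q h x).
Proof.
move=> hP; apply: coef_inj => j; rewrite !coef_transfer.
case hj: (h j) => [i|]; last by rewrite !if_same.
have [-> ->] := hP _ _ hj; rewrite coef_transfer.
case: (zz_at zz p' q' i) => //.
by case: (boolP (zz_at zz p q i)) => [//|/coef_out ->].
Qed.

Variables (I : finType) (zz : I -> zigzag).

Definition zsum_summand i : dcomplex K := zsum K (fun _ : unit => zz i).

Definition summand_index (i j : I) : option unit :=
  if j == i then Some tt else None.

Lemma summand_indexP i (j : I) (u : unit) : summand_index i j = Some u ->
  forall p q, zz_at zz p q j = zz_at (fun _ : unit => zz i) p q u.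
Proof. by rewrite /summand_index; case: eqP => // ->. Qed.

Definition zsum_inj_fun i p q : {linear zsum_summand i p q -> zsum K zz p q} :=
  @transfer K unit I (fun=> zz i) zz p q p q (summand_index i).

Lemma zsum_inj_del i p q (x : zsum_summand i p q) :
  zsum_inj_fun i (p + 1) q (del (zsum_summand i) p q x) =
  del (zsum K zz) p q (zsum_inj_fun i p q x).
Proof. by apply: transfer_comm => u j /summand_indexP uj; rewrite !uj. Qed.

Lemma zsum_inj_delbar i p q (x : zsum_summand i p q) :
  zsum_inj_fun i p (q + 1) (delbar (zsum_summand i) p q x) =
  delbar (zsum K zz) p q (zsum_inj_fun i p q x).
Proof. by apply: transfer_comm => u j /summand_indexP uj; rewrite !uj. Qed.

Definition zsum_inj i : dc_hom (zsum_summand i) (zsum K zz) :=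
  DCHom (@zsum_inj_del i) (@zsum_inj_delbar i).

Lemma transfer_unit_bij (Z : zigzag) p q p' q' :
  zigzag_supp Z (p, q) -> zigzag_supp Z (p', q') ->
  bijective (@transfer K unit unit (fun=> Z) (fun=> Z) p q p' q' Some).
Proof.
move=> S S'; exists (transfer _ p q Some) => x; apply: coef_inj => -[];
  by rewrite !coef_transfer /zz_at !asboolT.
Qed.

Lemma has_shape_zsum_summand i : has_shape (zsum_summand i) (Zigzag (zz i)).
Proof.
split=> p q.
- move=> S; exists (@const_elt K unit (fun=> zz i) p q).
  exists ((@coef K unit (fun=> zz i) p q)^~ tt) => [a|x].
    by rewrite of_coefK /zz_at asboolT.
  by apply: coef_inj => -[]; rewrite of_coefK /zz_at asboolT.
- move=> S x; apply: coef_inj => j; rewrite coef0 coef_out //.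
  exact/zz_atP.
- exact: transfer_unit_bij.
- exact: transfer_unit_bij.
Qed.

Lemma is_direct_sum_zsum : is_direct_sum zsum_inj.
Proof.
(* Only the inclusion of the summand [j] contributes to the coefficient at [j], so summing a family
   just collects its coefficients, and the family can be read off from its sum. *)
have sumE p q (f : forall i, zsum_summand i p q) :
    \sum_(i \in [set: I]) zsum_inj i p q (f i) =
    of_coef zz p q (fun i => coef (f i) tt).

  have finS : finite_set [set: I] by exact: finite_finset.
  rewrite (fsbigTE (fset_set [set: I])) => [|i]; last first.
    by rewrite in_fset_set // in_setT.
  apply: coef_inj => j; rewrite of_coefK.
  have coef_sum r : coef (\sum_(i <- r) zsum_inj i p q (f i)) j =
      \sum_(i <- r) coef (zsum_inj i p q (f i)) j.
    elim: r => [|i r IH]; first by rewrite !big_nil coef0.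
    by rewrite !big_cons -[X in X + _]scale1r coefP mul1r IH.
  have jT : j \in fset_set [set: I] by rewrite in_fset_set // in_setT.
  rewrite coef_sum (bigD1_seq j jT (fset_uniq _)) /=.
  rewrite big1 ?addr0 => [|i /negPf ij]; rewrite coef_transfer /summand_index.
    by rewrite eqxx.
  by rewrite eq_sym ij if_same.
have coef_inj_unit p q i (u v : zsum_summand i p q) :
    coef u tt = coef v tt -> u = v.
  by move=> uv; apply: coef_inj => -[].
move=> p q x.
exists (fun i => of_coef (fun=> zz i) p q (fun=> coef x i)); split.
  split; first exact: finite_finset.
  rewrite sumE; apply: coef_inj => j; rewrite of_coefK.
  case: (boolP (zz_at zz p q j)) => [Sj|/coef_out -> //].
  by rewrite of_coefK ifT.
move=> f [_]; rewrite sumE => ->; apply/functional_extensionality_dep => i.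
apply: coef_inj_unit; rewrite !of_coefK.
case: (boolP (zz_at (fun=> zz i) p q tt)) => [Si|/coef_out -> //].
by rewrite ifT.
Qed.

Definition zsum_dec : decomposition (zsum K zz) :=
  Decomposition has_shape_zsum_summand is_direct_sum_zsum.

End ZigzagSumDecomposition.

(** * Vanishing bidegrees and symmetry of multiplicities *)

Lemma zsum_obj0 (K : fieldType) (I : finType) (zz : I -> zigzag) (p q : int) :
  (forall i, ~ zigzag_supp (zz i) (p, q)) -> forall x : zsum K zz p q, x = 0.
Proof.
move=> out x; apply: coef_inj => i; rewrite coef0 coef_out //.
exact/zz_atP/out.
Qed.

(** The involution [s] realises [rho] on supports. Since a support determines its zigzag, [s] maps
    the indices of [Z] bijectively to those of its reflection. *)
Lemma mult_invariant_zsum (K : fieldType) (I : finType) (zz : I -> zigzag)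
    (rho : int * int -> int * int) (s : I -> I) :
  involutive rho -> involutive s ->
  (forall i v, zigzag_supp (zz (s i)) v <-> zigzag_supp (zz i) (rho v)) ->
  mult_invariant (zsum_dec K zz) rho.
Proof.
move=> rhoK sK szz Z Z' suppZ'.
have Z'P v : zigzag_supp Z' v <-> zigzag_supp Z (rho v).
  rewrite suppZ'; split=> [[u Zu <-]|Zv]; first by rewrite rhoK.
  by exists (rho v).
suff -> : mult_set (zsum_dec K zz) Z' =
    (s @` mult_set (zsum_dec K zz) Z)%classic.
  by apply: card_esym; apply: inj_card_eq => i j _ _; exact: inv_inj.
apply/seteqP; split=> i /= [].
  move=> zzi; exists (s i); last by rewrite sK.
  congr Zigzag; apply: zigzag_supp_inj; apply/seteqP.
  by split=> v; rewrite szz zzi Z'P rhoK.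
move=> j [zzj] <-; congr Zigzag; apply: zigzag_supp_inj; apply/seteqP.
by split=> v; rewrite szz zzj Z'P.
Qed.

(** * Isomorphisms of local complexes by relabelling summands *)

Section LocalIso.

Lemma trunc_map_comm (K : fieldType) (b c : bool) (V W V' W' : lmodType K)
    (f : {linear V -> W}) (g : {linear V' -> W'})
    (u : {linear V -> V'}) (v : {linear W -> W'}) (x : trunc b V) :
  (b -> c -> forall y, v (f y) = g (u y)) ->
  trunc_map c c v (trunc_map b c f x) = trunc_map b c g (trunc_map b b u x).
Proof. by case: b x => x; case: c => //= H; [exact: H|rewrite linear0]. Qed.

Lemma trunc_map_bij (K : fieldType) (b : bool) (V W : lmodType K)
    (f : {linear V -> W}) : (b -> bijective f) -> bijective (trunc_map b b f).
Proof.
case: b => [/(_ isT) //|_].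
by exists (fun=> 0) => x; apply/rowP; case.
Qed.

Variables (K : fieldType) (I : finType) (zz zz' : I -> zigzag) (s : I -> I).
Variables (p q : int).
Hypothesis sK : involutive s.
Hypothesis zzs : forall i r t, local_supp p q r t ->
  zz_at zz' r t i = zz_at zz r t (s i).

Definition relabel r t : {linear zsum K zz r t -> zsum K zz' r t} :=
  @transfer K I I zz zz' r t r t (Some \o s).

Lemma coef_relabel r t x i :
  coef (relabel r t x) i = if zz_at zz' r t i then coef x (s i) else 0.
Proof. exact: coef_transfer. Qed.

Lemma relabel_bij r t : local_supp p q r t -> bijective (relabel r t).
Proof.
move=> loc; exists (transfer zz r t (Some \o s)) => x; apply: coef_inj => i.
  rewrite coef_transfer /= coef_relabel zzs // sK.
  by case: (boolP (zz_at zz r t i)) => // /coef_out.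
rewrite coef_relabel coef_transfer /= sK zzs //.
case: (boolP (zz_at zz r t (s i))) => //.
by rewrite -zzs // => /coef_out.
Qed.

Definition local_relabel r t :
    {linear local_dc (@minimal_zsum K I zz) p q r t ->
            local_dc (@minimal_zsum K I zz') p q r t} :=
  trunc_map (local_supp p q r t) (local_supp p q r t) (relabel r t).

Lemma relabel_comm r t r' t' (x : zsum K zz r t) :
  local_supp p q r t -> local_supp p q r' t' ->
  transfer zz' r' t' (Some \o s) (transfer zz r' t' Some x) =
  transfer zz' r' t' Some (relabel r t x).
Proof.
by move=> loc loc'; apply: transfer_comm => i j [<-]; rewrite !zzs.
Qed.

Lemma local_relabel_del r t x :
  local_relabel (r + 1) t (del (local_dc (@minimal_zsum K I zz) p q) r t x) =
  del (local_dc (@minimal_zsum K I zz') p q) r t (local_relabel r t x).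
Proof. by apply: trunc_map_comm => loc loc' y; exact: relabel_comm. Qed.

Lemma local_relabel_delbar r t x :
  local_relabel r (t + 1) (delbar (local_dc (@minimal_zsum K I zz) p q) r t x) =
  delbar (local_dc (@minimal_zsum K I zz') p q) r t (local_relabel r t x).
Proof. by apply: trunc_map_comm => loc loc' y; exact: relabel_comm. Qed.

(** The relabelling [s] has to match supports only at the bidegrees retained around [(p, q)]. It may
    change with [(p, q)], so these isomorphisms need not come from a global one. *)
Lemma local_zsum_iso :
  dc_iso (local_dc (@minimal_zsum K I zz) p q)
    (local_dc (@minimal_zsum K I zz') p q).
Proof.
exists (DCHom local_relabel_del local_relabel_delbar) => r t.
exact/trunc_map_bij/relabel_bij.
Qed.

End LocalIso.

(** * Componentwise computation in an arbitrary decomposition *)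

Section Decompositions.
Variables (K : fieldType) (A : dcomplex K) (D : decomposition A).

(** Applying [g] can only shrink the support, so both sums may be taken over the finite support of
    [F]. *)
Lemma raddf_fsum (I : choiceType) (V W : zmodType) (g : {additive V -> W})
    (F : I -> V) : finite_set [set i | F i != 0] ->
  g (\sum_(i \in [set: I]) F i) = \sum_(i \in [set: I]) g (F i).
Proof.
move=> finF.
have out i : i \notin fset_set [set i | F i != 0] -> F i = 0.
  rewrite in_fset_set // => /negP out; apply/eqP/negPn/negP => Fi.
  by apply: out; exact: mem_set.
rewrite !(fsbigTE (fset_set [set i | F i != 0])) // => [|i /out ->].
  exact: raddf_sum.
exact: raddf0.
Qed.

Lemma dec_sum_uniq p q (f g : forall i : dec_index D, dec_summand i p q) :
  finite_set [set i | f i != 0] -> finite_set [set i | g i != 0] ->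
  \sum_(i \in [set: dec_index D]) Defs.dec_inj i p q (f i) =
  \sum_(i \in [set: dec_index D]) Defs.dec_inj i p q (g i) -> f = g.
Proof.
move=> finf fing fg.
have [h [_ hP]] :=
  dec_sum D (\sum_(i \in [set: dec_index D]) Defs.dec_inj i p q (f i)).
by rewrite -(hP f) // -(hP g).
Qed.

(** The family with [u] at [i] and zero elsewhere has the same sum as the zero family, so uniqueness
    of components identifies the two. *)
Lemma dec_inj_eq0 (i : dec_index D) p q (u : dec_summand i p q) :
  Defs.dec_inj i p q u = 0 -> u = 0.
Proof.
move=> iu0; pose f0 (j : dec_index D) : dec_summand j p q := 0.
have fE j : Defs.dec_inj j p q (dfwith f0 u j) = 0.
  by case: dfwithP => [|k _]; rewrite ?linear0.
have -> : u = dfwith f0 u i by rewrite dfwith_in.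
rewrite (_ : dfwith f0 u = f0) //; apply: dec_sum_uniq.
- apply: sub_finite_set (finite_set1 i) => j /=.
  by case: dfwithP => // k _; rewrite eqxx.
- apply: sub_finite_set (finite_set0 _) => j /=; by rewrite eqxx.
- by apply: eq_fsbigr => j _; rewrite fE linear0.
Qed.

(** Confines the shapes of every decomposition to the nonzero bidegrees of [A]. *)
Lemma shape_supp_neq0 i p q :
  shape_supp (dec_shape D i) (p, q) -> ~ forall x : A p q, x = 0.
Proof.
case: (dec_shapeP i) => + _ _ _ => /[apply] -[f /bij_inj f_inj] A0.
have /dec_inj_eq0 f10 := A0 (Defs.dec_inj i p q (f 1)).
by have /eqP := f_inj 1 0 (etrans f10 (esym (linear0 f))); rewrite oner_eq0.
Qed.

Lemma finite_support_sub (I : choiceType) (V W : I -> zmodType)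
    (f : forall i, V i) (g : forall i, W i) :
  finite_set [set i | f i != 0] -> (forall i, f i = 0 -> g i = 0) ->
  finite_set [set i | g i != 0].
Proof.
move=> finf fg; apply: sub_finite_set finf => i /=; apply: contra_neq.
exact: fg.
Qed.

Lemma del_dec_sum p q (f : forall i : dec_index D, dec_summand i p q) :
  finite_set [set i | f i != 0] ->
  del A p q (\sum_(i \in [set: dec_index D]) Defs.dec_inj i p q (f i)) =
  \sum_(i \in [set: dec_index D])
     Defs.dec_inj i (p + 1) q (del (dec_summand i) p q (f i)).
Proof.
move=> finf; rewrite raddf_fsum; last first.
  by apply: finite_support_sub finf _ => i ->; rewrite linear0.
by apply: eq_fsbigr => i _; rewrite dc_fun_del.
Qed.

Lemma delbar_dec_sum p q (f : forall i : dec_index D, dec_summand i p q) :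
  finite_set [set i | f i != 0] ->
  delbar A p q (\sum_(i \in [set: dec_index D]) Defs.dec_inj i p q (f i)) =
  \sum_(i \in [set: dec_index D])
     Defs.dec_inj i p (q + 1) (delbar (dec_summand i) p q (f i)).
Proof.
move=> finf; rewrite raddf_fsum; last first.
  by apply: finite_support_sub finf _ => i ->; rewrite linear0.
by apply: eq_fsbigr => i _; rewrite dc_fun_delbar.
Qed.

End Decompositions.

(** * The invariant detecting the zigzag of length five *)

(** The three elements sit at the vertices of total degree 2 of [Long 2 0 3]. The equations are well
    typed because sums of integer literals such as [0 + 1] compute. *)
Definition carries_zigzag5 (K : fieldType) (A : dcomplex K) : Prop :=
  exists (x : A 1 1) (y : A 0 2) (z : A 2 0),
    [/\ x <> 0, delbar A 1 1 x = del A 0 2 y & del A 1 1 x = delbar A 2 0 z].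

Lemma carries_zigzag5_summand (K : fieldType) (A : dcomplex K)
    (D : decomposition A) (i : dec_index D) :
  carries_zigzag5 (dec_summand i) -> carries_zigzag5 A.
Proof.
move=> [x [y [z [x0 xy xz]]]].
exists (Defs.dec_inj i _ _ x), (Defs.dec_inj i _ _ y), (Defs.dec_inj i _ _ z).
split; first by move/dec_inj_eq0.
  by rewrite -dc_fun_delbar xy; exact: (dc_fun_del (Defs.dec_inj i) y).
by rewrite -dc_fun_del xz; exact: (dc_fun_delbar (Defs.dec_inj i) z).
Qed.

(** By uniqueness of components both equations hold in each summand, so any summand where the
    component of [x] is nonzero will do. *)
Lemma exists_summand_carries_zigzag5 (K : fieldType) (A : dcomplex K)
    (D : decomposition A) :
  carries_zigzag5 A -> exists i : dec_index D, carries_zigzag5 (dec_summand i).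
Proof.
move=> [x [y [z [x0 xy xz]]]].
have [f [[finf xf] _]] := dec_sum D x.
have [g [[fing yg] _]] := dec_sum D y.
have [h [[finh zh] _]] := dec_sum D z.
have [i fi0] : exists i, f i <> 0.
  apply/existsNP => f0; apply: x0; rewrite xf; apply: fsbig1 => i _.
  by rewrite f0 linear0.
exists i, (f i), (g i), (h i); split=> //.
- pose u i : dec_summand i 1 2 := delbar (dec_summand i) 1 1 (f i).
  pose v i : dec_summand i 1 2 := del (dec_summand i) 0 2 (g i).
  suff uv : u = v by exact: (congr1 (fun w => w i) uv).
  apply: dec_sum_uniq.
  + by apply: finite_support_sub finf _ => j; rewrite /u => ->; exact: linear0.
  + by apply: finite_support_sub fing _ => j; rewrite /v => ->; exact: linear0.
  have := xy; rewrite {1}xf {1}yg delbar_dec_sum // del_dec_sum //.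
- pose u i : dec_summand i 2 1 := del (dec_summand i) 1 1 (f i).
  pose v i : dec_summand i 2 1 := delbar (dec_summand i) 2 0 (h i).
  suff uv : u = v by exact: (congr1 (fun w => w i) uv).
  apply: dec_sum_uniq.
  + by apply: finite_support_sub finf _ => j; rewrite /u => ->; exact: linear0.
  + by apply: finite_support_sub finh _ => j; rewrite /v => ->; exact: linear0.
  have := xz; rewrite {1}xf {1}zh del_dec_sum // delbar_dec_sum //.
Qed.

(** Take a generator at [(1, 1)] and pull its two differentials back along the isomorphisms leaving
    [(0, 2)] and [(2, 0)]. *)
Lemma has_shape_carries_zigzag5 (K : fieldType) (A : dcomplex K) :
  has_shape A (Zigzag (Long 2 0 3)) -> carries_zigzag5 A.
Proof.
move=> [dim1 _ delP delbarP].
have S (p q : int) : [&& 2 <= p + q, p + q <= 3, -2 <= p - q & p - q <= 2] ->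
    shape_supp (Zigzag (Long 2 0 3)) (p, q).
  by move=> pq; apply/zigzag_supp_Long; lia.
have [f /bij_inj f_inj] := dim1 1 1 (S 1 1 isT).
have [dinv _ dinvK] := delP 0 2 (S 0 2 isT) (S (0 + 1) 2 isT).
have [dbinv _ dbinvK] := delbarP 2 0 (S 2 0 isT) (S 2 (0 + 1) isT).
exists (f 1), (dinv (delbar A 1 1 (f 1))), (dbinv (del A 1 1 (f 1))).
split.
- by rewrite -(linear0 f) => /f_inj/eqP; rewrite oner_eq0.
- by symmetry; exact: (dinvK (delbar A 1 1 (f 1))).
- by symmetry; exact: (dbinvK (del A 1 1 (f 1))).
Qed.

(** * The two families of intervals and their comparison *)

(* The boolean c selects the path k, and in the coordinate p - q along the path
   the zigzag (c, b) is the interval [- b - 1, s b + 1]. *)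
Definition family (n : int) (s : bool -> bool) (i : bool * bool) : zigzag :=
  let k := if i.1 then 2 * n - 3 else 2 in
  Long k (k - i.2.+1%:Z) (i.2 + s i.2).+1.

Lemma family_suppP n s i p q : zigzag_supp (family n s i) (p, q) <->
  (if i.1 then p + q = 2 * n - 3 \/ p + q = 2 * n - 2
   else p + q = 2 \/ p + q = 3) /\
  - (i.2)%:Z - 1 <= p - q <= (s i.2)%:Z + 1.
Proof. by rewrite /family zigzag_supp_Long; case: i => -[] b /=; lia. Qed.

Lemma zz_at_family n s i p q : zz_at (family n s) p q i =
  (if i.1 then (p + q == 2 * n - 3) || (p + q == 2 * n - 2)
   else (p + q == 2) || (p + q == 3)) &&
  (- (i.2)%:Z - 1 <= p - q <= (s i.2)%:Z + 1).
Proof.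
apply/idP/idP => [/zz_atP/family_suppP|pq]; first by case: (i.1) => /=; lia.
by apply/zz_atP/family_suppP; move: pq; case: (i.1) => /=; lia.
Qed.

Lemma DCform_family (K : fieldType) (n : int) (s : bool -> bool) :
  4 <= n -> involutive s -> DCform n (zsum K (family n s)).
Proof.
move=> n4 sK; split.
  move=> p q out; apply: zsum_obj0 => -[c b] /family_suppP /=.
  by case: c; lia.
exists (zsum_dec K (family n s)); split.
- move=> [c b] Z [p q] [<-] corner /family_suppP /= supp.
  have bn : (b <= 1)%N by case: (b).
  have sbn : (s b <= 1)%N by case: (s b).
  by exfalso; case: corner => -[pE qE]; case: c supp; lia.
- exact: finite_finset.
(* The diagonal reflection negates [p - q], hence exchanges left and right ends; as [s] is an
   involution, this replaces [b] by [s b]. *)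
- apply: (@mult_invariant_zsum _ _ _ _ (fun i => (i.1, s i.2))).
  + by case.
  + by move=> [c b] /=; rewrite sK.
  + move=> [c b] [p q]; rewrite /refl_diag !family_suppP /= sK.
    by case: c; lia.
(* The antidiagonal reflection keeps [p - q] and sends total degree [d] to [2 * n - d], hence
   exchanges the two paths. *)
- apply: (@mult_invariant_zsum _ _ _ _ (fun i => (~~ i.1, i.2))).
  + by move=> [p q]; rewrite /refl_antidiag /=; congr (_, _); lia.
  + by move=> [c b] /=; rewrite negbK.
  + move=> [c b] [p q]; rewrite /refl_antidiag !family_suppP /=.
    by case: c => /=; lia.
Qed.

Lemma DCform_bounded (K : fieldType) (n : int) (A : dcomplex K) :
  DCform n A -> bounded_dc A.
Proof. by move=> [A0 _]; exists (n + n) => p q pq; apply: A0; lia. Qed.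

Lemma quasi_iso_refl (K : fieldType) (n : int) (A : dcomplex K) :
  DCform n A -> quasi_iso A A.
Proof.
move=> nA; have bA := DCform_bounded nA.
by case: nA => _ [D _]; split=> // Z; exists D, D; exact: card_eqxx.
Qed.

(* Around (p, q) with p <= q the right ends of the intervals are invisible, and
   around (p, q) with q <= p the left ends are. *)
Lemma locally_similar_family (K : fieldType) (n : int) : 4 <= n ->
  locally_similar (zsum K (family n id)) (zsum K (family n negb)).
Proof.
move=> n4; exists (zsum K (family n id)), (zsum K (family n negb)).
exists (@minimal_zsum _ _ _), (@minimal_zsum _ _ _); split.
- by apply: (@quasi_iso_refl _ n); apply: DCform_family.
- by apply: (@quasi_iso_refl _ n); apply: DCform_family => //; exact: negbK.
move=> p q.
(* Equal labels give equal left ends in the two families, opposite labels give equal right ends. *)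
apply: (@local_zsum_iso _ _ _ _
  (fun i => (i.1, if p <= q then i.2 else ~~ i.2))).
  by move=> [c b] /=; case: (p <= q); rewrite ?negbK.
move=> [c b] r t; rewrite /local_supp /zz_at => loc.
apply: asbool_equiv_eq; rewrite !family_suppP /=.
by case: (lerP p q) => pq; case: b; case: c => /=; lia.
Qed.

Lemma carries_zigzag5_family (K : fieldType) (n : int) :
  carries_zigzag5 (zsum K (family n id)).
Proof.
(* The index [(false, true)] gives the interval [[-2, 2]], that is, [Long 2 0 3]. *)
apply: (@carries_zigzag5_summand _ _ (zsum_dec K (family n id)) (false, true)).
apply: has_shape_carries_zigzag5.
exact: (@has_shape_zsum_summand K _ (family n id) (false, true)).
Qed.

(** The lower interval [[-2, 1]] misses [(2, 0)] and [[-1, 2]] misses [(0, 2)]. At the missing end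
    [z] or [y] has coefficient zero, and the matching equation kills that coefficient of [x]. *)
Lemma not_carries_zigzag5_family (K : fieldType) (n : int) : 4 <= n ->
  ~ carries_zigzag5 (zsum K (family n negb)).
Proof.
move=> n4 [x [y [z [x0 xy xz]]]]; apply: x0; apply: coef_inj => -[c b].
rewrite coef0.
case: c; first by apply: coef_out; rewrite zz_at_family /=; lia.
case: b.
  have := congr1 (fun w => @coef K _ (family n negb) 2 1 w (false, true)) xz.
  rewrite !coef_transfer !zz_at_family /= => ->.
  by rewrite (coef_out z) // zz_at_family.
have := congr1 (fun w => @coef K _ (family n negb) 1 2 w (false, false)) xy.
rewrite !coef_transfer !zz_at_family /= => ->.
by rewrite (coef_out y) // zz_at_family.
Qed.

(** Every interval through [(1, 1)] also contains [(2, 1)]. This excludes degenerate witnesses [x]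
    with vanishing [del], such as a dot would provide. *)
Lemma family_del_inj (K : fieldType) (n : int) (x : zsum K (family n id) 1 1) :
  4 <= n -> del (zsum K (family n id)) 1 1 x = 0 -> x = 0.
Proof.
move=> n4 dx; apply: coef_inj => -[c b]; rewrite coef0.
case: c; first by apply: coef_out; rewrite zz_at_family /=; lia.
have := congr1 (fun w => @coef K _ (family n id) 2 1 w (false, b)) dx.
by rewrite coef0 coef_transfer zz_at_family; case: b.
Qed.

Lemma family_delbar_inj (K : fieldType) (n : int)
    (x : zsum K (family n id) 1 1) :
  4 <= n -> delbar (zsum K (family n id)) 1 1 x = 0 -> x = 0.
Proof.
move=> n4 dx; apply: coef_inj => -[c b]; rewrite coef0.
case: c; first by apply: coef_out; rewrite zz_at_family /=; lia.
have := congr1 (fun w => @coef K _ (family n id) 1 2 w (false, b)) dx.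
by rewrite coef0 coef_transfer zz_at_family; case: b.
Qed.

(** Injectivity at [(1, 1)] makes both differentials of [x] nonzero, hence also [y] and [z], so the
    shape covers all five vertices; the nonzero bidegrees of the ambient complex prevent it from
    being larger. *)
Lemma zigzag5_shape (K : fieldType) (n : int)
    (D : decomposition (zsum K (family n id))) (i : dec_index D) : 4 <= n ->
  carries_zigzag5 (dec_summand i) -> dec_shape D i = Zigzag (Long 2 0 3).
Proof.
move=> n4 [x [y [z [x0 xy xz]]]].
(* The bound 4 separates the lower path from the mirrored one, which starts at total degree
   [2 * n - 3 >= 5], and still includes every corner of a square through [(1, 1)]. *)
have at_shape (p q : int) : p + q <= 4 -> shape_supp (dec_shape D i) (p, q) ->
    [&& 2 <= p + q, p + q <= 3, -2 <= p - q & p - q <= 2].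
  move=> pq4 /shape_supp_neq0 A0; apply: contrapT => out; apply: A0.
  by apply: zsum_obj0 => -[c b] /family_suppP /=; case: c; lia.
have inj_x0 : Defs.dec_inj i 1 1 x <> 0 by move/dec_inj_eq0.
have dx0 : del (dec_summand i) 1 1 x <> 0.
  move=> dx; apply/inj_x0/(family_del_inj n4).
  by rewrite -dc_fun_del dx linear0.
have dbx0 : delbar (dec_summand i) 1 1 x <> 0.
  move=> dx; apply/inj_x0/(family_delbar_inj n4).
  by rewrite -dc_fun_delbar dx linear0.
have supp_neq0 p q (u : dec_summand i p q) :
    u <> 0 -> shape_supp (dec_shape D i) (p, q).
  case: (dec_shapeP i) => _ out _ _ u0; apply: contrapT => /out/(_ u).
  exact: u0.
have S11 := supp_neq0 _ _ x x0.
have S21 := supp_neq0 _ _ _ dx0.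
have S12 := supp_neq0 _ _ _ dbx0.
have S02 : shape_supp (dec_shape D i) (0, 2).
  apply: (supp_neq0 _ _ y) => y0; apply: dbx0; rewrite xy y0.
  exact: linear0.
have S20 : shape_supp (dec_shape D i) (2, 0).
  apply: (supp_neq0 _ _ z) => z0; apply: dx0; rewrite xz z0.
  exact: linear0.
case: (dec_shape D i) at_shape S11 S21 S12 S02 S20
  => [a b|[a b|k t m]] at_shape.
(* Opposite corners of a square differ by 2 in total degree, so they cannot both have degree 2 or
   3. *)
- move=> S11 _ _ _ _; exfalso.
  have S00 : shape_supp (Square a b) (a, b) by do 3 left.
  have S1 : shape_supp (Square a b) (a + 1, b + 1) by right.
  have ab : [\/ (1, 1) = (a, b), (1, 1) = (a + 1, b), (1, 1) = (a, b + 1)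
             | (1, 1) = (a + 1, b + 1)].
    by case: S11 => [[[]|]|] ?;
      [exact: Or41|exact: Or42|exact: Or43|exact: Or44].
  have := at_shape _ _ _ S00; have := at_shape _ _ _ S1.
  by case: ab => -[? ?]; lia.
- by move=> [<- <-] [].
move=> /zigzag_supp_Long S11 /zigzag_supp_Long S21 /zigzag_supp_Long S12.
move=> /zigzag_supp_Long S02 /zigzag_supp_Long S20.
have out (p q : int) : p + q <= 4 -> (p - q < -2) || (2 < p - q) ->
    ~ zigzag_supp (Long k t m) (p, q).
  by move=> pq4 pq /(at_shape _ _ pq4); lia.
have k2 : k = 2 by lia.
(* The bidegrees [(3, 0)] and [(0, 3)] are the path neighbours just beyond [(2, 0)] and [(0, 2)];
   their absence fixes both ends. *)
have /zigzag_supp_Long := out 3 0 isT isT.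
have /zigzag_supp_Long := out 0 3 isT isT.
by move=> out03 out30; congr (Zigzag (Long _ _ _)); lia.
Qed.

Theorem theorem1p2 (R : realType) (n : int) (n_ge4 : 4 <= n) :
  exists A B : dcomplex R[i],
    [/\ DCform n A, DCform n B, locally_similar A B
      & exists Z : zigzag, ~ same_mult A B Z].
Proof.
exists (zsum R[i] (family n id)), (zsum R[i] (family n negb)); split.
- exact: DCform_family.
- by apply: DCform_family => //; exact: negbK.
- exact: locally_similar_family.
(* The decompositions [DA] and [DB] are arbitrary: the index set of this zigzag is shown to be empty
   in every [DB] and inhabited in every [DA]. *)
exists (Long 2 0 3) => -[DA [DB]].
have -> : mult_set DB (Long 2 0 3) = set0.
  apply/seteqP; split=> // j /= shape_j.
  apply: (not_carries_zigzag5_family n_ge4).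
  apply: (carries_zigzag5_summand (i := j)); apply: has_shape_carries_zigzag5.
  by rewrite -shape_j; exact: dec_shapeP.
rewrite card_eq0 => /eqP multA0.
have [i /(zigzag5_shape n_ge4) shape_i] :=
  exists_summand_carries_zigzag5 DA (carries_zigzag5_family R[i] n).
by have : mult_set DA (Long 2 0 3) i by []; rewrite multA0.
Qed.
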